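(* Let $\mathcal Y=[0,1]$ and $\delta\in(0,1]$. With probability at least $1-\delta$, simultaneously for all integers $T\ge10$ and all $y\in[0,1]$, $$F(y)\in\left[\sup_{y_-\in[0,y]}\Big(\hat F_T(y_-)-D_T\big(y_-,\log\tfrac{2\sqrt T}{(y-y_-)\delta}\big)\Big),\ \inf_{y_+\in[y,1]}\Big(\hat F_T(y_+)+D_T\big(y_+,\log\tfrac{2\sqrt T}{(y_+-y)\delta}\big)\Big)\right],$$ where $$D_T(y,C)=\frac{8C}{3T}+\sqrt{\frac{4C\hat V_T(y)}{T}}.$$
   Context: Let $(X_t)_{t\ge1}$ be i.i.d. random variables with Borel probability law $P$ on $\mathcal X\subset\mathbb R^d$. Let $f:\mathcal X\times\mathcal Y\to[0,1]$ be a Borel function such that for each $x\in\mathcal X$ the map $y\mapsto f(x,y)$ is non-decreasing. Define $F:\mathcal Y\to[0,1]$ by $F(y)=\mathbb E_P[f(X,y)]$. For $T\ge1$ and $y\in\mathcal Y$, the sample mean is $\hat F_T(y)=\frac1T\sum_{t=1}^Tf(X_t,y)$ and the empirical variance is $\hat V_T(y)=\frac1T\sum_{t=1}^T\big(f(X_t,y)-\hat F_T(y)\big)^2$. Conventions: $1/0=+\infty$, $\log(+\infty)=+\infty$, $0\times\infty=0$; thus $D_T(y,+\infty)=+\infty$. $\log$ is the natural logarithm. *)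

(* Defs.v *)
From HB Require Import structures.
From mathcomp Require Export all_boot all_order all_algebra finmap.
From mathcomp Require Export all_classical all_reals all_analysis.
Export Order.TTheory GRing.Theory Num.Theory.
Export numFieldNormedType.Exports.

Set Implicit Arguments.
Unset Strict Implicit.
Unset Printing Implicit Defensive.

Local Open Scope classical_set_scope.
Local Open Scope ring_scope.

(* A subset A of a topological space as a measurable space: the points are those
   of the subtype A, and the measurable sets are the Borel sets of the subspace
   topology. A itself need not be Borel. Measurable types are pointed in the
   library, hence the witness a; it plays no other role. *)
Section BorelSubset.
Context {T : topologicalType} {A : set T}.

Definition pointed_subset (a : A) : Type := A.

HB.instance Definition _ (a : A) := Choice.on (pointed_subset a).
HB.instance Definition _ (a : A) := isPointed.Build (pointed_subset a) a.

Definition borel_subset (a : A) :=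
  @g_sigma_algebraType (pointed_subset a) (@open A).

HB.instance Definition _ (a : A) := Measurable.on (borel_subset a).

End BorelSubset.

Section Probability.
Context {d : measure_display} {Omega : measurableType d} {R : realType}.

Definition mutually_independent (Pr : probability Omega R)
    {I : choiceType} {d' : measure_display} {S : measurableType d'}
    (X : I -> Omega -> S) : Prop :=
  forall (J : {fset I}) (B : I -> set S),
    (forall i, measurable (B i)) ->
    Pr (\bigcap_(i in [set` J]) (X i @^-1` B i)) =
      (\prod_(i <- J) Pr (X i @^-1` B i))%E.

Definition iid_with_law (Pr : probability Omega R)
    {I : choiceType} {d' : measure_display} {S : measurableType d'}
    (P : probability S R) (X : I -> {RV Pr >-> S}) : Prop :=
  mutually_independent Pr (fun i => X i : Omega -> S) /\
  forall (i : I) (B : set S), measurable B -> distribution Pr (X i) B = P B.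

(* E may be defined by uncountably many conditions, and is not assumed to be
   measurable; for measurable E this says p <= Pr E. *)
Definition with_probability_at_least (Pr : probability Omega R) (p : R)
    (E : set Omega) : Prop :=
  exists2 A : set Omega, measurable A /\ A `<=` E & (p%:E <= Pr A)%E.

End Probability.

(* x is a realization of the sample, x t being the value of X_(t+1): the indices
   1, ..., T of the sample are shifted to 0, ..., T-1. *)
Section EmpiricalBernstein.
Context {R : realType} {S : Type}.
Implicit Types (f : S -> R -> R) (x : nat -> S) (T : nat) (y : R) (C : \bar R).

Definition sample_mean f x T y : R :=
  T%:R^-1 * \sum_(t < T) f (x t) y.

Definition empirical_variance f x T y : R :=
  T%:R^-1 * \sum_(t < T) (f (x t) y - sample_mean f x T y) ^+ 2.

(* D_T(y, C). The conventions 0 * +oo = 0, sqrt(+oo) = +oo are those of the library. *)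
Definition deviation f x T y C : \bar R :=
  (8%:E * C / (3 * T%:R)%:E +
   sqrte (4%:E * C * (empirical_variance f x T y)%:E / T%:R%:E))%E.

(* log (2 sqrt T / (h delta)), with value +oo at h = 0: the library has
   0^-1 = +oo in \bar R and lne +oo = +oo. *)
Definition log_level (T : nat) (h delta : R) : \bar R :=
  lne ((2 * Num.sqrt T%:R)%:E / (h * delta)%:E)%E.

Definition lower_bound f x T delta y : \bar R :=
  ereal_sup [set ((sample_mean f x T z)%:E -
                  deviation f x T z (log_level T (y - z) delta))%E
            | z in `[0, y]].

Definition upper_bound f x T delta y : \bar R :=
  ereal_inf [set ((sample_mean f x T z)%:E +
                  deviation f x T z (log_level T (z - y) delta))%E
            | z in `[y, 1]].

End EmpiricalBernstein.

(* Main.v *)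
Require Import Defs.
From mathcomp Require Import measurable_realfun ring lra.

(** Testing by betting. For a rate b in [0, 1] and a level y, the product over t
    of 1 + b (f(X_t, y) - F y) is a nonnegative martingale of mean 1, and so is its
    average over y uniform in [0, 1]; by Ville's inequality and a union bound over
    the rates b = 2^-(k+1), with probability at least 1 - delta / 2 none of these
    averages ever reaches 2 / (delta b). Since f(x, .) and F are non-decreasing,
    f(x, y') - F y' >= f(x, z) - F y for y' in [z, y], so the average over y' is at
    least (y - z) times the product over t of 1 + b (f(X_t, z) - F y). Were
    mean f(X_t, z) - F y larger than the claimed deviation, a suitable dyadic b
    (any within a factor of about 2 of the optimal rate, and at least 1 / sqrt T)
    would make this exceed 2 / (delta b). The upper bound is the same statement
    for 1 - f. *)

Set Implicit Arguments.
Unset Strict Implicit.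
Unset Printing Implicit Defensive.

Local Open Scope classical_set_scope.
Local Open Scope ring_scope.

(** * Ville's inequality for mixtures of products *)

Lemma ge0_integral_indep_pair {d1 d2 d3 : measure_display}
    {Omega : measurableType d1} {O : measurableType d2} {S : measurableType d3}
    {R : realType} (Pr : probability Omega R) (P : probability S R)
    (Y : {mfun Omega >-> O}) (Z : {mfun Omega >-> S}) (phi : O * S -> \bar R) :
  (forall A B, measurable A -> measurable B ->
     Pr (Y @^-1` A `&` Z @^-1` B) = (Pr (Y @^-1` A) * P B)%E) ->
  measurable_fun setT phi -> (forall p, (0 <= phi p)%E) ->
  (\int[Pr]_w phi (Y w, Z w) =
   \int[distribution Pr Y]_u \int[P]_x phi (u, x))%E.
Proof.
move=> indep mphi phi0.
have mYZ : measurable_fun [set: Omega] (fun w => (Y w, Z w)).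
  by apply: measurable_fun_pair.
pose YZ : {mfun Omega >-> (O * S)%type} := mfun_Sub (mem_set mYZ).
rewrite -(fubini_tonelli1 phi mphi phi0).
transitivity (\int[distribution Pr YZ]_z phi z)%E.
  by rewrite ge0_integral_distribution.
apply: eq_measure_integral => /= A mA _.
symmetry; exact: product_measure_unique.
Qed.

(** * The sigma-algebra generated by the first [n] observations *)

Section History.
Context {dO dS : measure_display} {Omega : measurableType dO}
  {S : measurableType dS}.
Implicit Types X : nat -> Omega -> S.

Definition cylinders X (n : nat) : set (set Omega) :=
  [set A | exists2 B : nat -> set S, (forall i, measurable (B i)) &
     A = \bigcap_(i in `I_n) X i @^-1` B i].

(** The points are those of [Omega], with the coarser sigma-algebra of the events determined by the
    observations of index below [n]. The past is thus a measurable type of its own, over which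
    Tonelli's theorem can be applied. *)
Definition history X (n : nat) := g_sigma_algebraType (cylinders X n).

Lemma setI_closed_cylinders X n : setI_closed (cylinders X n).
Proof.
move=> _ _ [B mB ->] [C mC ->]; exists (fun i => B i `&` C i).
  by move=> i; exact: measurableI.
by rewrite -bigcapI.
Qed.

Lemma cylinders_setT X n : cylinders X n setT.
Proof.
by exists (fun=> setT) => //; rewrite bigcapT.
Qed.

Lemma measurable_history_coordinate X n i : (i < n)%N ->
  measurable_fun [set: history X n] (X i : history X n -> S).
Proof.
move=> ltin _ B mB; rewrite setTI; apply: sub_sigma_algebra.
exists (fun j => if j == i then B else setT).
  by move=> j; case: ifP.
apply/seteqP; split=> [w Xw j _|w /(_ i ltin)] /=; last by rewrite eqxx.
by case: eqP => // ->.
Qed.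

Lemma measurable_to_history (X : nat -> {mfun Omega >-> S}) n :
  measurable_fun [set: Omega] (id : Omega -> history X n).
Proof.
move=> _ A mA; rewrite setTI preimage_id.
apply: smallest_sub A mA; first exact: sigma_algebra_measurable.
move=> _ [B mB ->]; apply: bigcap_measurableType => i _.
exact: measurable_funPTI.
Qed.

(** The identity, seen as one random element that carries the whole past; it is the [Y] to which
    [ge0_integral_indep_pair] is applied. *)
Definition to_history (X : nat -> {mfun Omega >-> S}) n :
  {mfun Omega >-> history X n} := mfun_Sub (mem_set (@measurable_to_history X n)).

End History.

(** * Martingale property of the mixture and the maximal inequality *)

Section Ville.
Context {dO dS dT : measure_display} {Omega : measurableType dO}
  {S : measurableType dS} {Theta : measurableType dT} {R : realType}.
Variables (Pr : probability Omega R) (P : probability S R)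
  (X : nat -> {RV Pr >-> S}).
Hypothesis X_iid : iid_with_law P X.

Lemma iid_cylinder_indep n (A : set Omega) (B : set S) :
  cylinders (fun i => X i) n A -> measurable B ->
  Pr (A `&` X n @^-1` B) = (Pr A * P B)%E.
Proof.
move=> [C mC ->] mB.
have [indep law] := X_iid.
pose J := [fset i | i in iota 0 n]%fset.
have JE i : (i \in J) = (i < n)%N by rewrite !inE mem_iota add0n.
(* Placing [B] at index [n] turns the left side into one intersection over the indices up to [n];
   mutual independence is then used twice, with and without [n]. *)
pose D i := if i == n then B else C i.
have mD i : measurable (D i) by rewrite /D; case: ifP.
have DC i : (i < n)%N -> D i = C i by rewrite /D => /ltn_eqF ->.
have setJ : [set` J] = `I_n by apply/seteqP; split=> i /=; rewrite JE.
have -> : \bigcap_(i in `I_n) X i @^-1` C i =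
          \bigcap_(i in [set` J]) X i @^-1` D i.
  by rewrite setJ; apply: eq_bigcapr => i /= /DC ->.
have -> : X n @^-1` B = X n @^-1` D n by rewrite /D eqxx.
have -> : P B = Pr (X n @^-1` D n) by rewrite /D eqxx -(law n).
rewrite setIC -(bigcap_setU1 (fun i => X i @^-1` D i)).
have -> : n |` [set` J] = [set` (n |` J)%fset].
  by apply/seteqP; split=> i /=; rewrite in_fset1U => /predU1P.
by rewrite !indep// big_fsetU1/= 1?muleC// JE ltnn.
Qed.

(** Both sides are finite measures in [A] that agree on the cylinders, which form a pi-system
    generating [history]. *)
Lemma history_indep n (A : set (history (fun i => X i) n)) (B : set S) :
  measurable A -> measurable B ->
  Pr (A `&` X n @^-1` B) = (Pr A * P B)%E.
Proof.
move=> mA mB.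
have mXB : measurable (X n @^-1` B) by exact: measurable_funPTI.
have PB0 : (0 <= fine (P B))%R by rewrite fine_ge0.
pose m1 := pushforward (mrestr Pr mXB) (to_history X n).
pose m2 := mscale (NngNum PB0) (distribution Pr (to_history X n)).
suff : m1 A = m2 A.
  rewrite -[X in X = _ -> _]/(Pr (A `&` X n @^-1` B)).
  rewrite -[X in _ = X -> _]/((fine (P B))%:E * Pr A)%E.
  by rewrite fineK ?fin_num_measure// muleC.
apply: (@measure_unique _ R (history (fun i => X i) n)
  (cylinders (fun i => X i) n) (fun=> setT) _ _ _ _ m1 m2) => //.
- exact: setI_closed_cylinders.
- by move=> _; exact: cylinders_setT.
- by rewrite bigcup_const.
- move=> C cC; rewrite -[LHS]/(Pr (C `&` X n @^-1` B)).
  rewrite -[RHS]/((fine (P B))%:E * Pr C)%E.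
  by rewrite (iid_cylinder_indep cC)// fineK ?fin_num_measure// muleC.
- move=> _; rewrite -[X in (X < _)%E]/(Pr (setT `&` X n @^-1` B)) setTI.
  by rewrite -ge0_fin_numE// fin_num_measure.
Qed.

Variables (mu : probability Theta R) (g : Theta -> S -> R).
Hypotheses (mg : measurable_fun setT (fun p : Theta * S => g p.1 p.2))
  (g_ge0 : forall th x, 0 <= g th x)
  (g_mean1 : forall th, (\int[P]_x (g th x)%:E = 1)%E).

Definition mixture_wealth n w : \bar R :=
  (\int[mu]_th (\prod_(t < n) g th (X t w))%:E)%E.

(** [N] may exceed [n], since events about the wealth at several earlier times have to be measured
    in a single history. *)
Lemma measurable_wealth_product n N : (n <= N)%N ->
  measurable_fun setT (fun p : history (fun i => X i) N * Theta =>
    \prod_(t < n) g p.2 (X t p.1)).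
Proof.
move=> nN; apply: measurable_prod => t _.
apply: (measurableT_comp mg (g := fun p : history (fun i => X i) N * Theta =>
  (p.2, X t p.1))).
apply: measurable_fun_pair; first exact: measurable_snd.
apply: measurableT_comp measurable_fst.
exact: (measurable_history_coordinate (X := fun i => X i) (leq_trans (ltn_ord t) nN)).
Qed.

Lemma measurable_mixture_wealth n N : (n <= N)%N ->
  measurable_fun setT (mixture_wealth n : history (fun i => X i) N -> \bar R).
Proof.
move=> nN; apply: (measurable_fun_fubini_tonelli_F (m2 := mu)
  (fun p : history (fun i => X i) N * Theta => (\prod_(t < n) g p.2 (X t p.1))%:E)).
  by apply/measurable_EFinP; exact: measurable_wealth_product.
by move=> p; rewrite lee_fin prodr_ge0.
Qed.

Lemma mixture_wealth_ge0 n w : (0 <= mixture_wealth n w)%E.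
Proof. by apply: integral_ge0 => th _; rewrite lee_fin prodr_ge0. Qed.

Lemma measurable_set_history n (A : set (history (fun i => X i) n)) :
  measurable A -> measurable (A : set Omega).
Proof.
by move=> mA; have := @measurable_to_history _ _ _ _ X n measurableT _ mA; rewrite setTI.
Qed.

(** The new observation is independent of the past, and each new factor has mean 1. Conditional
    expectation is expressed by integrals over the events [A] of the past. *)
Lemma mixture_wealth_martingale n (A : set (history (fun i => X i) n)) :
  measurable A ->
  (\int[Pr]_(w in A) mixture_wealth n.+1 w = \int[Pr]_(w in A) mixture_wealth n w)%E.
Proof.
move=> mA.
(* The indicator of [A] and the first [n] factors depend on the past only; absorbing them into [z]
   makes the integrand a function of the pair (past, new observation). *)
pose z (u : history (fun i => X i) n) th : R := \1_A u * \prod_(t < n) g th (X t u).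
have z_ge0 u th : 0 <= z u th by rewrite mulr_ge0// prodr_ge0.
have mz : measurable_fun setT (fun p : history (fun i => X i) n * Theta => z p.1 p.2).
  apply: measurable_funM; last exact: measurable_wealth_product.
  apply: (measurableT_comp _ measurable_fst); exact: measurable_indic.
pose phi (p : history (fun i => X i) n * S) :=
  (\int[mu]_th (z p.1 th * g th p.2)%:E)%E.
have mzg : measurable_fun setT (fun q : (history (fun i => X i) n * S) * Theta =>
    (z q.1.1 q.2 * g q.2 q.1.2)%:E).
  apply/measurable_EFinP; apply: measurable_funM.
    apply: (measurableT_comp mz (g := fun q : (history (fun i => X i) n * S) * Theta =>
      (q.1.1, q.2))).
    apply: measurable_fun_pair; last exact: measurable_snd.
    exact: measurableT_comp measurable_fst.
  apply: (measurableT_comp mg (g := fun q : (history (fun i => X i) n * S) * Theta =>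
    (q.2, q.1.2))).
  apply: measurable_fun_pair; first exact: measurable_snd.
  exact: measurableT_comp measurable_fst.
have mphi : measurable_fun setT phi.
  apply: (measurable_fun_fubini_tonelli_F (m2 := mu) _ mzg) => q.
  by rewrite lee_fin mulr_ge0.
have phi_ge0 p : (0 <= phi p)%E.
  by apply: integral_ge0 => th _; rewrite lee_fin mulr_ge0.
transitivity (\int[Pr]_w phi (to_history X n w, X n w))%E.
  rewrite integral_mkcond; apply: eq_integral => w _.
  rewrite patchE /phi /z/= indicE; case: ifP => wA.
    by apply: eq_integral => th _; rewrite mul1r big_ord_recr.
  by under eq_integral do rewrite mul0r mul0r; rewrite integral0.
rewrite (ge0_integral_indep_pair (P := P))//; last first.
  by move=> B C mB mC; exact: history_indep.
transitivity (\int[distribution Pr (to_history X n)]_u \int[mu]_th (z u th)%:E)%E.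
  apply: eq_integral => u _.
  (* With the past [u] fixed, the new observation is integrated before [th], so that its factor
     becomes 1 by [g_mean1]. *)
  rewrite (fubini_tonelli (fun p : S * Theta => (z u p.2 * g p.2 p.1)%:E))/=.
  - apply: eq_integral => th _.
    under eq_integral do rewrite EFinM.
    rewrite ge0_integralZl ?lee_fin// ?g_mean1 ?mule1//.
    + apply/measurable_EFinP.
      exact: (measurableT_comp mg (pair1_measurable th)).
    + by move=> x _; rewrite lee_fin.
  - apply: (measurableT_comp mzg (g := fun p : S * Theta => ((u, p.1), p.2))).
    apply: measurable_fun_pair => //; apply: measurable_fun_pair => //.
  - by move=> p; rewrite lee_fin mulr_ge0.
rewrite ge0_integral_distribution; first last.
- by move=> u; apply: integral_ge0 => th _; rewrite lee_fin.
- apply: (measurable_fun_fubini_tonelli_F (m2 := mu) (fun p => (z p.1 p.2)%:E)).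
    exact/measurable_EFinP.
  by move=> p; rewrite lee_fin.
rewrite [RHS]integral_mkcond; apply: eq_integral => w _.
rewrite patchE /z/= indicE; case: ifP => wA.
  by apply: eq_integral => th _; rewrite mul1r.
by under eq_integral do rewrite mul0r; rewrite integral0.
Qed.

Definition poor_before (c : R) n : set Omega :=
  \bigcap_(m in `I_n) [set w | (mixture_wealth m w < c%:E)%E].

(** [poor_before c n] involves the wealth at times at most [n - 1], whence [N.+1]:
    [poor_before c n.+1] is already an event of [history n], as the martingale step requires. *)
Lemma measurable_poor_before c n N : (n <= N.+1)%N ->
  measurable (poor_before c n : set (history (fun i => X i) N)).
Proof.
move=> nN; apply: bigcap_measurableType => m /= mn.
rewrite -[X in measurable X]setTI; apply: emeasurable_fun_infty_o => //.
by apply: measurable_mixture_wealth; rewrite -ltnS (leq_trans mn).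
Qed.


Lemma measurable_mixture_wealth_sample n :
  measurable_fun setT (mixture_wealth n : Omega -> \bar R).
Proof.
apply: measurableT_comp (measurable_mixture_wealth (leqnn n)) _.
exact: measurable_to_history.
Qed.

Lemma poor_beforeS c n :
  poor_before c n.+1 = poor_before c n `&` [set w | (mixture_wealth n w < c%:E)%E].
Proof.
apply/seteqP; split=> [w /= W|w [W Wn] m /=].
  by split=> [m /= mn|]; apply: W => /=; rewrite ltnS// ltnW.
by rewrite ltnS leq_eqVlt => /predU1P[->//|]; exact: W.
Qed.

(** The left side bounds from below the mean of the wealth stopped on reaching [c]; it equals 1 at
    time 0 and does not increase with [n]. *)
Lemma ville_step c n : 0 <= c ->
  (c%:E * Pr (~` poor_before c n) +
    \int[Pr]_(w in poor_before c n) mixture_wealth n w <= 1)%E.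
Proof.
move=> c0; elim: n => [|n IH].
  have -> : poor_before c 0 = setT by apply/seteqP; split=> // w _ m.
  rewrite setCT measure0 mule0 add0e.
  have wealth0 w : mixture_wealth 0 w = 1%E.
    rewrite /mixture_wealth; under eq_integral do rewrite big_ord0.
    by rewrite integral_cst//= probability_setT mul1e.
  under eq_integral do rewrite wealth0.
  by rewrite integral_cst//= probability_setT mul1e.
apply: le_trans IH.
rewrite mixture_wealth_martingale; last exact: measurable_poor_before.
set D := poor_before c n; set D' := poor_before c n.+1.
(* [H] is the event that the wealth first reaches [c] at time [n]. The wealth is at least [c] there,
   so the integral over [H] dominates the increase of the term in [c]. *)
pose H := D `&` [set w | (c%:E <= mixture_wealth n w)%E].
have mD : measurable (D : set Omega).
  by apply: (@measurable_set_history n); exact: measurable_poor_before.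
have mD' : measurable (D' : set Omega).
  by apply: (@measurable_set_history n); exact: measurable_poor_before.
have mW := measurable_mixture_wealth_sample n.
have mH : measurable (H : set Omega).
  by apply: emeasurable_fun_c_infty => //; exact: measurable_funTS.
have HD' : H `|` D' = D.
  rewrite /D' poor_beforeS -setIUr; apply/setIidPl => w _ /=.
  by case: (leP c%:E (mixture_wealth n w)) => ?; [left|right].
have CD' : ~` D' = ~` D `|` H.
  rewrite /D' poor_beforeS setCI; apply/seteqP; split=> w /=.
    have [Dw [//|/negP]|nDw _] := pselect (D w); last by left.
    by rewrite -leNgt; right.
  by case=> [|[_ cW]]; [left|right; apply/negP; rewrite -leNgt].
have dHD' : [disjoint H & D'].
  rewrite /D' poor_beforeS disj_set2E; apply/eqP; rewrite -subset0 => w /= [[_ cW] [_ Wc]].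
  by move: (le_lt_trans cW Wc); rewrite ltxx.
have -> : (\int[Pr]_(w in D) mixture_wealth n w =
    \int[Pr]_(w in H) mixture_wealth n w + \int[Pr]_(w in D') mixture_wealth n w)%E.
  rewrite -{1}HD' ge0_integral_setU//; first exact: measurable_funTS.
  by move=> w _; exact: mixture_wealth_ge0.
rewrite (addeA (c%:E * Pr (~` D))%E); apply: leeD2r.
apply: (@le_trans _ _ (c%:E * Pr (~` D) + c%:E * Pr H)%E).
  rewrite -ge0_muleDr//; apply: lee_wpmul2l; first by rewrite lee_fin.
  by rewrite CD'; apply: measureU2 => //; exact: measurableC.
apply: leeD2l; rewrite -integral_cst//; apply: ge0_le_integral => //.
- exact: measurable_funTS.
- by move=> w [].
Qed.

(** Dropping the integral in [ville_step] bounds the probability of reaching [c] before time [n] by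
    [c^-1]; continuity from below passes to the union over [n]. *)
Theorem mixture_ville c : 0 < c ->
  (Pr (\bigcup_n [set w | (c%:E <= mixture_wealth n w)%E]) <= (c^-1)%:E)%E.
Proof.
move=> c0.
have mC n : measurable (~` poor_before c n).
  apply: measurableC; apply: (@measurable_set_history n).
  exact: measurable_poor_before.
have -> : \bigcup_n [set w | (c%:E <= mixture_wealth n w)%E] =
    \bigcup_n ~` poor_before c n.
  apply/seteqP; split=> w [n _ /= H].
    by exists n.+1 => //= /(_ n (ltnSn n)) /=; rewrite ltNge H.
  have : (~` poor_before c n) w by [].
  rewrite setC_bigcap => -[m _ /= /negP].
  by rewrite -leNgt => ?; exists m.
have /cvg_lim <- // : Pr (~` poor_before c n) @[n --> \oo] -->
    Pr (\bigcup_n ~` poor_before c n).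
  apply: nondecreasing_cvg_mu => //; first exact: bigcup_measurable.
  move=> n m nm; apply/subsetPset; apply: subsetC => w W k /= kn.
  by apply: W => /=; exact: leq_trans nm.
apply: lime_le.
  apply: ereal_nondecreasing_is_cvgn => n m nm; apply: le_measure; rewrite ?inE//.
  apply: subsetC => w W k /= kn.
  by apply: W => /=; exact: leq_trans nm.
apply: nearW => n.
rewrite -[leRHS]mule1 -lee_pdivrMl ?invr_gt0// invrK.
apply: le_trans (ville_step n (ltW c0)).
by rewrite leeDl// integral_ge0// => w _; exact: mixture_wealth_ge0.
Qed.
End Ville.

(** * Wealth at the best dyadic rate *)

Section ExpBounds.
Context {R : realType}.
Implicit Types (x u t : R).

(** The derivative of [p * exp q] is [(p' + p q') exp q], so comparing [p] with an exponential
    reduces to the sign of a polynomial. *)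
Lemma le_poly_mul_expR (p q : {poly R}) (M : R) : 0 <= M ->
  (forall x, 0 <= x <= M -> 0 <= (deriv p).[x] + p.[x] * (deriv q).[x]) ->
  p.[0] * expR q.[0] <= p.[M] * expR q.[M].
Proof.
move=> M0 pos.
pose F (x : R) := p.[x] * expR q.[x].
have dF x : is_derive x 1 F (((deriv p).[x] + p.[x] * (deriv q).[x]) * expR q.[x]).
  have dE := is_derive1_comp (is_derive_expR q.[x]) (is_derive_poly q x).
  apply: (is_derive_eq (is_deriveM (is_derive_poly p x) dE)).
  rewrite /GRing.scale/=; ring.
apply: (ger0_derive1_le_cc (f := F) (a := 0) (b := M)) => //.
- move=> x; rewrite in_itv/= => /andP[x0 xM].
  by rewrite derive1E derive_val mulr_ge0 ?expR_ge0// pos// !ltW.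
- by apply: derivable_within_continuous => x _.
- by rewrite in_itv/= lexx.
- by rewrite in_itv/= lexx andbT.
Qed.

Lemma expR_le1Dx_ge0 x : 0 <= x -> expR (x - x ^+ 2 / 2) <= 1 + x.
Proof.
move=> x0; rewrite -[leLHS]mul1r -ler_pdivlMr ?expR_gt0// -expRN opprB.
pose q : {poly R} := 2^-1 *: 'X^2 - 'X.
have qE y : q.[y] = y ^+ 2 / 2 - y by rewrite !hornerE/=; field.
have := @le_poly_mul_expR (1 + 'X) q x x0.
rewrite !qE !hornerE/= expr0n mul0r subr0 expR0; apply => y /andP[y0 _].
by rewrite !poly.derivE !hornerE/=; nra.
Qed.

(** The coefficient 2/3 makes the polynomial [p' + p q'] equal to [y^2 (1 - 2 y)], which is
    nonnegative up to 1/2. *)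
Lemma expR_le1Bt t : 0 <= t <= 2^-1 ->
  expR (- (t + t ^+ 2 / 2 + t ^+ 3 * (2 / 3))) <= 1 - t.
Proof.
move=> /andP[t0 t12]; rewrite expRN -[leLHS]mul1r ler_pdivrMr ?expR_gt0//.
pose q : {poly R} := 'X + 2^-1 *: 'X^2 + (2 / 3) *: 'X^3.
have qE y : q.[y] = y + y ^+ 2 / 2 + y ^+ 3 * (2 / 3) by rewrite !hornerE/=; field.
have := @le_poly_mul_expR (1 - 'X) q t t0.
rewrite !qE !hornerE/= !(oppr0, expr0n, mul0r, addr0, expR0, mulr1)/=; apply => y /andP[y0 yt].
rewrite !poly.derivE !hornerE/=.
rewrite [leRHS](_ : _ = y ^+ 2 * (1 - 2 * y)); last by field.
by rewrite mulr_ge0 ?sqr_ge0//; lra.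
Qed.

(** For negative [u], put [t = -u <= 1/2]: the cubic term [2/3 t^3] is at most [t^2 / 3], and 1/2 +
    1/3 = 5/6. *)
Lemma expR_le1Du u : - 2^-1 <= u -> expR (u - 5 / 6 * u ^+ 2) <= 1 + u.
Proof.
move=> u12; case: (leP 0 u) => [u0|u0].
  apply: le_trans (expR_le1Dx_ge0 u0); rewrite ler_expR; nra.
have -> : 1 + u = 1 - (- u) by rewrite opprK.
have u1 : 0 <= - u <= 2^-1 by apply/andP; split; lra.
apply: le_trans (expR_le1Bt u1); rewrite ler_expR.
have -> : - (- u + (- u) ^+ 2 / 2 + (- u) ^+ 3 * (2 / 3)) =
    u - u ^+ 2 / 2 + u ^+ 2 * u * 2 / 3 by field.
have := sqr_ge0 u; nra.
Qed.

End ExpBounds.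

(** * From the wealth of a wager to an empirical Bernstein deviation *)

Section Wager.
Context {R : realType}.

Lemma mean_itv01 (T : nat) (a : nat -> R) : (0 < T)%N ->
  (forall t, 0 <= a t <= 1) -> 0 <= T%:R^-1 * \sum_(t < T) a t <= 1.
Proof.
move=> T0 a01; apply/andP; split.
  by rewrite mulr_ge0 ?invr_ge0 ?ler0n// sumr_ge0// => t _; case/andP: (a01 t).
rewrite ler_pdivrMl ?ltr0n// mulr1 -[in leRHS](card_ord T) -sumr_const.
by apply: ler_sum => t _; case/andP: (a01 t).
Qed.

(** Since [a t ^+ 2 <= a t], the variance is at most [mean (1 - mean)], hence at most 1/4. *)
Lemma variance_le (T : nat) (a : nat -> R) : (0 < T)%N ->
  (forall t, 0 <= a t <= 1) ->
  let mean := T%:R^-1 * \sum_(t < T) a t in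
  T%:R^-1 * \sum_(t < T) (a t - mean) ^+ 2 <= 4^-1.
Proof.
move=> T0 a01 /=; set mean := _ * \sum_(t < T) a t.
have TR0 : 0 < T%:R :> R by rewrite ltr0n.
have sum_a : \sum_(t < T) a t = T%:R * mean by rewrite mulrA divff ?mul1r ?gt_eqF.
rewrite ler_pdivrMl//.
apply: (@le_trans _ _ (\sum_(t < T) ((1 - 2 * mean) * a t + mean ^+ 2))).
  apply: ler_sum => t _; have /andP[a0 a1] := a01 t.
  have : a t * a t <= a t by rewrite ler_piMr.
  lra.
rewrite big_split/= -mulr_sumr sum_a sumr_const card_ord -mulr_natl.
have : 0 <= T%:R * (mean - 2^-1) ^+ 2 by rewrite mulr_ge0 ?sqr_ge0// ltW.
lra.
Qed.

(* The factor at rate b is split as (1 + x) (1 + b' (a t - mean)), with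
   x = b (mean - m) and b' = b / (1 + x), so that the linear terms of the second
   factors cancel. *)
Lemma wager_prod_ge (T : nat) (a : nat -> R) (m b : R) :
  (0 < T)%N -> (forall t, 0 <= a t <= 1) -> 0 <= b <= 2^-1 ->
  let mean := T%:R^-1 * \sum_(t < T) a t in
  let var := T%:R^-1 * \sum_(t < T) (a t - mean) ^+ 2 in
  let x := b * (mean - m) in
  0 <= x ->
  expR (T%:R * (x - x ^+ 2 / 2 - 5 / 6 * b ^+ 2 * var)) <=
    \prod_(t < T) (1 + b * (a t - m)).
Proof.
move=> T0 a01 /andP[b0 b12] mean var x x0.
have TR0 : 0 < T%:R :> R by rewrite ltr0n.
have sum_a : \sum_(t < T) a t = T%:R * mean by rewrite mulrA divff ?mul1r ?gt_eqF.
have sum_var : \sum_(t < T) (a t - mean) ^+ 2 = T%:R * var.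
  by rewrite mulrA divff ?mul1r ?gt_eqF.
have mean01 : 0 <= mean <= 1 by exact: mean_itv01.
have x1 : 0 < 1 + x by lra.
pose b' := b / (1 + x).
have b'0 : 0 <= b' by rewrite divr_ge0// ltW.
have b'b : b' <= b by rewrite ler_pdivrMr// ler_peMr//; lra.
pose u t := b' * (a t - mean).
have uE t : 1 + b * (a t - m) = (1 + x) * (1 + u t).
  rewrite /u /b' /x; field; rewrite /x in x1; exact: lt0r_neq0.
(* This is the range of [expR_le1Du]: [b' <= b <= 1/2], and the centred values are at least -1. *)
have u12 t : - 2^-1 <= u t.
  have /andP[a0 a1] := a01 t; have /andP[m0 m1] := mean01.
  have : - 1 <= a t - mean by lra.
  rewrite /u => ?; nra.
under eq_bigr do rewrite uE.
rewrite big_split/= prodr_const card_ord.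
apply: (@le_trans _ _ (expR (x - x ^+ 2 / 2) ^+ T *
    \prod_(t < T) expR (u t - 5 / 6 * u t ^+ 2))).
  rewrite -expRM_natl -expR_sum -expRD ler_expR.
  rewrite sumrB.
  have -> : \sum_(t < T) u t = 0.
    by rewrite -mulr_sumr sumrB sum_a sumr_const card_ord mulr_natl subrr mulr0.
  rewrite -mulr_sumr.
  have -> : \sum_(t < T) u t ^+ 2 = b' ^+ 2 * (T%:R * var).
    by rewrite -sum_var mulr_sumr; apply: eq_bigr => t _; rewrite exprMn.
  have var0 : 0 <= T%:R * var by rewrite -sum_var sumr_ge0// => t _; exact: sqr_ge0.
  have : b' ^+ 2 * (T%:R * var) <= b ^+ 2 * (T%:R * var).
    by rewrite ler_wpM2r// ler_sqr ?nnegrE.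
  lra.
apply: ler_pM; rewrite ?exprn_ge0 ?expR_ge0//.
- by rewrite prodr_ge0// => t _; exact: expR_ge0.
- by rewrite lerXn2r ?nnegrE ?expR_ge0 ?(ltW x1)//; exact: expR_le1Dx_ge0.
- by apply: ler_prod => t _; rewrite expR_ge0/=; exact: expR_le1Du.
Qed.

(** The largest dyadic rate not exceeding [y] works: it is not 1/2, and its double, also a dyadic
    rate, exceeds [y]. *)
Lemma exists_dyadic (y : R) : 0 < y < 2^-1 ->
  exists k : nat, y / 2 <= (2 ^ k.+1)%:R^-1 <= y.
Proof.
move=> /andP[y0 y12].
have [n yn] : exists n : nat, (2 ^ n.+1)%:R^-1 <= y.
  exists (Num.bound y^-1); rewrite -[leRHS]invrK lef_pV2 ?posrE ?invr_gt0// ?ltr0n ?expn_gt0//.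
  apply: le_trans (ltW (archi_boundP _)) _; first by rewrite invr_ge0 ltW.
  by rewrite ler_nat ltnW// (leq_trans (ltn_expl _ (ltnSn 1)))// leq_exp2l.
have [[|k] yk kmin] := ex_minnP (ex_intro (fun n => (2 ^ n.+1)%:R^-1 <= y) n yn).
  by move: yk; rewrite expn1 leNgt y12.
exists k.+1; rewrite yk andbT ltW// ltNge.
apply/negP => H; suff : (k.+1 <= k)%N by rewrite ltnn.
apply: kmin; move: H; rewrite expnS natrM invfM.
by rewrite mulrC ler_pM2r// invr_gt0.
Qed.

(* Up to higher order terms, b G - 5/6 b^2 s^2 = (4 rho - 10/3 rho^2) r^2 with
   rho = b s / (2 r), and 4 rho - 10/3 rho^2 > 1 on [2/5, 4/5], an interval that
   contains a dyadic value of rho; the rate 1/2 is used when s is so small that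
   rho would need b > 1/2. *)
Lemma exists_rate (r s G : R) : 0 < r -> 0 <= s <= 2^-1 ->
  8 / 3 * r ^+ 2 + 2 * s * r < G -> G <= 1 ->
  exists k : nat, let b := (2 ^ k.+1)%:R^-1 in
    r ^+ 2 <= b * G - (b * G) ^+ 2 / 2 - 5 / 6 * b ^+ 2 * s ^+ 2 /\
    (b = 2^-1 \/ 8 / 5 * r <= b).
Proof.
move=> r0 /andP[s0 s12] rsG G1.
have G0 : 0 <= G.
  by apply: le_trans (ltW rsG); rewrite addr_ge0 ?mulr_ge0 ?sqr_ge0// ltW.
(* The map [x - x^2 / 2] is non-decreasing on [0, 1], so [G] may be replaced by its lower bound. *)
have mono b : 0 <= b <= 2^-1 ->
    let x := b * (8 / 3 * r ^+ 2 + 2 * s * r) in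
    x - x ^+ 2 / 2 <= b * G - (b * G) ^+ 2 / 2.
  move=> /andP[b0 b12] /=; set x := _ * (_ + _).
  have xG : x <= b * G by rewrite ler_wpM2l// ltW.
  have b1 : b <= 1 by lra.
  have G12 : b * G <= 1 by rewrite mulr_ile1.
  have : 0 <= (b * G - x) * (1 - (b * G + x) / 2) by rewrite mulr_ge0//; lra.
  lra.
(* The threshold 16/5 is where the upper target [8 r / (5 s)] for the rate crosses 1/2. At rate 1/2,
   [x <= 1/2] gives [x - x^2 / 2 >= 3/4 x = r^2 + 3/4 s r], while the variance term [5/24 s^2] is at
   most [2/3 s r]. *)
case: (leP s (16 / 5 * r)) => sr.
  exists 0; rewrite expn1 /=; split; last by left.
  have := mono 2^-1; rewrite lexx invr_ge0 ler0n => /(_ isT) /=.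
  set x := _ * (_ + _).
  have xE : x = 4 / 3 * r ^+ 2 + s * r by rewrite /x; field.
  have r20 : 0 <= r ^+ 2 by exact: sqr_ge0.
  have x0 : 0 <= x by rewrite xE addr_ge0// ?mulr_ge0// ltW.
  have x12 : x <= 2^-1 by rewrite xE; lra.
  have x2 : x ^+ 2 <= x / 2 by rewrite expr2 ler_wpM2l.
  have s2 : s ^+ 2 <= 16 / 5 * (s * r) by rewrite expr2 mulrCA ler_wpM2l.
  have sr0 : 0 <= s * r by rewrite mulr_ge0// ltW.
  set lhs := _ - _ / 2 => H; apply: le_trans (lerB H (lexx _)).
  rewrite /lhs; lra.
have s_gt0 : 0 < s by lra.
have [] := @exists_dyadic (8 / 5 * r / s).
  rewrite !(divr_gt0, mulr_gt0)//= ltr_pdivrMr//; lra.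
move=> k /andP[]; set b := (2 ^ k.+1)%:R^-1 => bl br; exists k; rewrite -/b.
have {br}pr : b * s <= 8 / 5 * r by rewrite -ler_pdivlMr.
have {bl}pl : 4 / 5 * r <= b * s.
  rewrite -ler_pdivrMr// (le_trans _ bl)// [leLHS](_ : _ = 8 / 5 * r / s / 2)//.
  by field; exact: lt0r_neq0.
have b0 : 0 < b by rewrite invr_gt0 ltr0n expn_gt0.
(* From [4/5 r <= b s] and [s <= 1/2]. *)
have br : 8 / 5 * r <= b by nra.
split; last by right.
have b12 : b <= 2^-1.
  by rewrite lef_pV2 ?posrE ?ltr0n ?expn_gt0// ler_nat expnS leq_pmulr// expn_gt0.
have := mono b; rewrite (ltW b0) b12 => /(_ isT) /=.
set x := _ * (_ + _) => H; apply: le_trans (lerB H (lexx _)).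
set p := b * s in pl pr.
have xE : x = 8 / 3 * (b * r ^+ 2) + 2 * p * r by rewrite /x /p; ring.
have x0 : 0 <= x by rewrite mulr_ge0 ?addr_ge0 ?mulr_ge0// ltW.
have r20 : 0 <= r ^+ 2 by exact: sqr_ge0.
have rb : r ^+ 2 <= 25 / 128 * b by nra.
have xr : x <= 68 / 15 * r ^+ 2 by rewrite xE; nra.
(* The loss [x^2 / 2] is thus absorbed by the summand [8/3 b r^2] of [x], leaving at least
   [2 p r]. *)
have x2 : x ^+ 2 <= 5 * (b * r ^+ 2).
  apply: (@le_trans _ _ ((68 / 15 * r ^+ 2) ^+ 2)).
    by rewrite ler_sqr ?nnegrE// mulr_ge0.
  nra.
(* Expanded, this says [5/6 p^2 <= 2 p r - 16/15 r^2], so that [2 p r - 5/6 p^2 >= r^2]. *)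
have pp : 0 <= (p - 4 / 5 * r) * (8 / 5 * r - p) by rewrite mulr_ge0//; lra.
have -> : 5 / 6 * b ^+ 2 * s ^+ 2 = 5 / 6 * p ^+ 2 by rewrite /p; field.
have br20 : 0 <= b * r ^+ 2 by rewrite mulr_ge0// ltW.
rewrite [in X in X <= _]xE in x2 *.
nra.
Qed.

(** With [r = sqrt (C / T)] and [s = sqrt var] the deviation is [8/3 r^2 + 2 s r]. If it were
    exceeded, the rate [b] of [exists_rate] would give a product of at least
    [exp (T r^2) = exp C = 2 sqrt T L], and this is at least [2 L / b] because [b >= 1 / sqrt T]. *)
Lemma mean_sub_le_deviation (T : nat) (a : nat -> R) (m L : R) :
  (10 <= T)%N -> (forall t, 0 <= a t <= 1) -> 0 <= m -> 1 <= L ->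
  let mean := T%:R^-1 * \sum_(t < T) a t in
  let var := T%:R^-1 * \sum_(t < T) (a t - mean) ^+ 2 in
  let C := ln (2 * Num.sqrt T%:R * L) in
  (forall k, let b := (2 ^ k.+1)%:R^-1 in
    \prod_(t < T) (1 + b * (a t - m)) < 2 * L / b) ->
  mean - m <= 8 * C / (3 * T%:R) + Num.sqrt (4 * C * var / T%:R).
Proof.
move=> T10 a01 m0 L1 mean var C wealth.
have T0 : (0 < T)%N by rewrite (leq_trans _ T10).
have TR0 : 0 < T%:R :> R by rewrite ltr0n.
have sT0 : 0 < Num.sqrt T%:R :> R by rewrite sqrtr_gt0.
have sT3 : 3 <= Num.sqrt T%:R :> R.
  rewrite -ler_sqr ?nnegrE ?sqrtr_ge0// sqr_sqrtr ?ler0n// -natrX ler_nat.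
  exact: leq_trans T10.
have arg0 : 0 < 2 * Num.sqrt T%:R * L by rewrite !mulr_gt0// (lt_le_trans ltr01).
(* The argument of the logarithm is at least 6, and [exp 1 <= 4] follows from
   [exp (-1/2) >= 1/2]. *)
have C1 : 1 <= C.
  rewrite -[leLHS]expRK ler_ln ?posrE ?expR_gt0//.
  have e12 : 2^-1 <= expR (- 2^-1) :> R.
    by apply: le_trans (expR_ge1Dx _); lra.
  have : expR 1 * (expR (- 2^-1) * expR (- 2^-1)) = 1 :> R.
    by rewrite -!expRD -[RHS]expR0; congr expR; lra.
  have := expR_gt0 (1 : R) => e0 e1.
  have : 2^-1 * 2^-1 <= expR (- 2^-1) * expR (- 2^-1) :> R by rewrite ler_pM.
  have : 6 <= 2 * Num.sqrt T%:R * L by nra.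
  nra.
have var0 : 0 <= var.
  by rewrite mulr_ge0 ?invr_ge0 ?ler0n// sumr_ge0// => t _; exact: sqr_ge0.
have /andP[_ mean1] : 0 <= mean <= 1 by exact: mean_itv01.
have var14 : var <= 4^-1 by exact: variance_le.
rewrite leNgt; apply/negP => H.
pose r := Num.sqrt (C / T%:R); pose s := Num.sqrt var.
have r2 : r ^+ 2 = C / T%:R.
  by rewrite sqr_sqrtr// divr_ge0 ?(ltW TR0)// (le_trans ler01).
have s2 : s ^+ 2 = var by rewrite sqr_sqrtr.
have r0 : 0 < r by rewrite sqrtr_gt0 divr_gt0// (lt_le_trans ltr01).
have s12 : 0 <= s <= 2^-1.
  rewrite sqrtr_ge0 -ler_sqr ?nnegrE ?sqrtr_ge0// s2; lra.
have s0 : 0 <= s by case/andP: s12.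
have dev_rs : 8 * C / (3 * T%:R) + Num.sqrt (4 * C * var / T%:R) =
    8 / 3 * r ^+ 2 + 2 * s * r.
  have -> : 4 * C * var / T%:R = (2 * s * r) ^+ 2.
    by rewrite !exprMn r2 s2; field; exact: lt0r_neq0.
  rewrite sqrtr_sqr ger0_norm ?mulr_ge0 ?(ltW r0)// r2; field; exact: lt0r_neq0.
rewrite dev_rs in H.
have G1 : mean - m <= 1 by lra.
have [k] := exists_rate r0 s12 H G1.
set b := (2 ^ k.+1)%:R^-1 => /= -[rk bk].
have b0 : 0 < b by rewrite invr_gt0 ltr0n expn_gt0.
have b12 : 0 <= b <= 2^-1.
  by rewrite ltW// lef_pV2 ?posrE ?ltr0n ?expn_gt0// ler_nat expnS leq_pmulr// expn_gt0.
have x0 : 0 <= b * (mean - m).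
  by rewrite mulr_ge0 ?(ltW b0)// (le_trans _ (ltW H))// addr_ge0 ?mulr_ge0 ?sqr_ge0// ltW.
have : expR C < 2 * L / b.
  apply: le_lt_trans (wealth k); apply: le_trans (wager_prod_ge T0 a01 b12 x0).
  rewrite ler_expR -/mean -/var -s2.
  have -> : C = T%:R * r ^+ 2 by rewrite r2 mulrC divfK ?lt0r_neq0.
  by rewrite ler_wpM2l// ltW.
rewrite lnK ?posrE// ltr_pdivlMr//; apply/negP; rewrite -leNgt.
(* The product is [sqrt C], so [C1] applies; both alternatives in [bk] then yield
   [b >= 1 / sqrt T]. *)
have sTr : 1 <= Num.sqrt T%:R * r.
  rewrite -sqrtrM ?ler0n// mulrC divfK ?lt0r_neq0//.
  by rewrite -ler_sqr ?nnegrE ?sqrtr_ge0// sqr_sqrtr ?(le_trans ler01)// expr1n.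
have sTb : 1 <= Num.sqrt T%:R * b by case: bk => [->|?]; nra.
rewrite [leRHS](_ : _ = 2 * L * (Num.sqrt T%:R * b)); last by ring.
by rewrite ler_peMr// mulr_ge0// (le_trans ler01).
Qed.
End Wager.

(** * Uniform mixtures over the level *)

Section UniformMixture.
Context {dO dS : measure_display} {Omega : measurableType dO}
  {S : measurableType dS} {R : realType}.
Variables (Pr : probability Omega R) (P : probability S R)
  (X : nat -> {RV Pr >-> S}).
Hypothesis X_iid : iid_with_law P X.
Variable phi : S -> R -> R.
Hypotheses (mphi : measurable_fun setT (fun p : S * R => phi p.1 p.2))
  (phi01 : forall x y, 0 <= phi x y <= 1).

Definition mean_value y : R := fine (\int[P]_x (phi x y)%:E)%E.

Let mphi_x y : measurable_fun setT (phi^~ y).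
Proof. exact: (measurableT_comp mphi (pair2_measurable y)). Qed.

Let phi_ge0 x y : 0 <= phi x y. Proof. by case/andP: (phi01 x y). Qed.

Lemma integral_itv01 y : (0 <= \int[P]_x (phi x y)%:E <= 1)%E.
Proof.
rewrite integral_ge0/= => [|x _]; last by rewrite lee_fin.
apply: (@le_trans _ _ (\int[P]_x cst 1 x)%E); last first.
  by rewrite integral_cst//= probability_setT mul1e.
apply: ge0_le_integral => //.
- by move=> x _; rewrite lee_fin.
- exact/measurable_EFinP.
- by move=> x _; rewrite lee_fin; case/andP: (phi01 x y).
Qed.

Lemma mean_valueE y : ((mean_value y)%:E = \int[P]_x (phi x y)%:E)%E.
Proof.
have /andP[i0 i1] := integral_itv01 y.
by rewrite fineK// ge0_fin_numE// (le_lt_trans i1) ?ltry.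
Qed.

Lemma mean_value_itv01 y : 0 <= mean_value y <= 1.
Proof. by rewrite -!lee_fin mean_valueE; exact: integral_itv01. Qed.

Lemma measurable_mean_value : measurable_fun setT mean_value.
Proof.
apply/measurable_EFinP.
apply: (eq_measurable_fun (fun y => \int[P]_x (phi x y)%:E)%E).
  by move=> y _; rewrite /= mean_valueE.
apply: (measurable_fun_fubini_tonelli_F (m2 := P) (fun p : R * S => (phi p.2 p.1)%:E)).
  apply/measurable_EFinP.
  apply: (measurableT_comp mphi (g := fun p : R * S => (p.2, p.1))).
  by apply: measurable_fun_pair.
by move=> p; rewrite lee_fin.
Qed.

Definition wager (b : R) (y : R) (x : S) : R := 1 + b * (phi x y - mean_value y).

Lemma wager_ge0 b y x : 0 <= b <= 1 -> 0 <= wager b y x.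
Proof.
move=> /andP[b0 b1]; have /andP[p0 p1] := phi01 x y.
by have /andP[m0 m1] := mean_value_itv01 y; rewrite /wager; nra.
Qed.

Lemma measurable_wager b :
  measurable_fun setT (fun p : R * S => wager b p.1 p.2).
Proof.
apply: measurable_funD => //; apply: measurable_funM => //.
apply: measurable_funB.
  apply: (measurableT_comp mphi (g := fun p : R * S => (p.2, p.1))).
  by apply: measurable_fun_pair.
exact: measurableT_comp measurable_mean_value _.
Qed.

Lemma integral_wager b y : 0 <= b <= 1 -> (\int[P]_x (wager b y x)%:E = 1)%E.
Proof.
move=> /andP[b0 b1]; have /andP[m0 m1] := mean_value_itv01 y.
have c0 : 0 <= 1 - b * mean_value y by nra.
(* Regrouped as a sum of two nonnegative terms, to which additivity of nonnegative integrals
   applies. *)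
under eq_integral => x _.
  rewrite (_ : wager b y x = (1 - b * mean_value y) + b * phi x y); last first.
    by rewrite /wager; ring.
  rewrite EFinD EFinM; over.
rewrite ge0_integralD//=; first last.
- by apply/measurable_EFinP; exact: measurable_funM.
- by move=> x _; rewrite lee_fin mulr_ge0.
rewrite ge0_integralZl//; first last.
- by move=> x _; rewrite lee_fin.
- exact/measurable_EFinP.
rewrite -mean_valueE integral_cst//= probability_setT mule1 -EFinM -EFinD.
by rewrite subrK.
Qed.

Definition dyadic_rate (k : nat) : R := (2 ^ k.+1)%:R^-1.

Lemma dyadic_rate_gt0 k : 0 < dyadic_rate k.
Proof. by rewrite invr_gt0 ltr0n expn_gt0. Qed.

Lemma dyadic_rate_le1 k : 0 <= dyadic_rate k <= 1.
Proof.
by rewrite ltW ?dyadic_rate_gt0// invf_le1 ?ltr0n ?expn_gt0// ler1n expn_gt0.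
Qed.

Definition uniform_wealth k :=
  mixture_wealth X (uniform_prob (@ltr01 R)) (wager (dyadic_rate k)).

Definition wealthy_at (delta : R) k : set Omega :=
  \bigcup_n [set w | ((2 / (delta * dyadic_rate k))%:E <= uniform_wealth k n w)%E].

Definition wealthy (delta : R) : set Omega := \bigcup_k wealthy_at delta k.

Lemma measurable_wealthy_at delta k : measurable (wealthy_at delta k).
Proof.
apply: bigcup_measurable => n _.
rewrite -[X in measurable X]setTI; apply: emeasurable_fun_c_infty => //.
apply: measurable_mixture_wealth_sample; first exact: measurable_wager.
by move=> y x; rewrite wager_ge0// dyadic_rate_le1.
Qed.

Lemma measurable_wealthy delta : measurable (wealthy delta).
Proof. by apply: bigcup_measurable => k _; exact: measurable_wealthy_at. Qed.

(** The threshold at rate [b] costs [delta b / 2] by Ville's inequality, and the dyadic rates sum to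
    1. *)
Lemma wealthy_probability delta : 0 < delta -> (Pr (wealthy delta) <= (delta / 2)%:E)%E.
Proof.
move=> delta0; have mB := measurable_wealthy_at delta.
apply: le_trans (measure_sigma_subadditive Pr mB (measurable_wealthy delta) _) _ => //.
apply: le_trans (epsilon_trick0 xpredT _); last by rewrite divr_ge0// ltW.
apply: lee_nneseries => [k _ _|k _]; first exact: measure_ge0.
have c0 : 0 < 2 / (delta * dyadic_rate k) by rewrite divr_gt0 ?mulr_gt0 ?dyadic_rate_gt0.
apply: le_trans (mixture_ville X_iid _ _ _ _ c0) _.
- exact: measurable_wager.
- by move=> y x; rewrite wager_ge0// dyadic_rate_le1.
- by move=> y; rewrite integral_wager// dyadic_rate_le1.
by rewrite lee_fin invf_div /dyadic_rate mulrAC.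
Qed.

Lemma uniform_wealth_ge k n w u v (c : R) : 0 <= u -> u < v -> v <= 1 -> 0 <= c ->
  (forall y, u <= y <= v -> c <= \prod_(t < n) wager (dyadic_rate k) y (X t w)) ->
  ((c * (v - u))%:E <= uniform_wealth k n w)%E.
Proof.
move=> u0 uv v1 c0 c_le.
pose W y := \prod_(t < n) wager (dyadic_rate k) y (X t w).
have W0 y : (0 <= (W y)%:E)%E.
  by rewrite lee_fin prodr_ge0// => t _; rewrite wager_ge0// dyadic_rate_le1.
have mW : measurable_fun setT (fun y => (W y)%:E).
  apply/measurable_EFinP; apply: measurable_prod => t _.
  exact: (measurableT_comp (measurable_wager _) (pair2_measurable (X t w))).
rewrite /uniform_wealth /mixture_wealth integral_uniform// subr0 invr1 mul1e.
apply: (@le_trans _ _ (\int[lebesgue_measure]_(y in `[u, v]) (W y)%:E)%E); last first.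
  apply: ge0_subset_integral => //; first exact: measurable_funTS.
  by apply: subset_itv; rewrite bnd_simp.
apply: (@le_trans _ _ (\int[lebesgue_measure]_(y in `[u, v]) cst c%:E y)%E).
  by rewrite integral_cst//= lebesgue_measure_itv/= lte_fin uv -EFinD -EFinM.
apply: ge0_le_integral => //.
- exact: measurable_funTS.
Qed.

(** Monotonicity enters only through the domination of [a t - m] on all of [[u, v]], so the same
    statement serves [f] with [[z, y]] and [1 - f] with [[y, z]]. *)
Theorem uniform_deviation delta w (T : nat) (a : nat -> R) (m u v : R) :
  0 < delta <= 1 -> ~ wealthy delta w -> (10 <= T)%N ->
  (forall t, 0 <= a t <= 1) -> 0 <= m <= 1 -> 0 <= u -> u < v -> v <= 1 ->
  (forall y t, u <= y <= v -> a t - m <= phi (X t w) y - mean_value y) ->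
  let mean := T%:R^-1 * \sum_(t < T) a t in
  let var := T%:R^-1 * \sum_(t < T) (a t - mean) ^+ 2 in
  let C := ln (2 * Num.sqrt T%:R / ((v - u) * delta)) in
  mean - m <= 8 * C / (3 * T%:R) + Num.sqrt (4 * C * var / T%:R).
Proof.
move=> /andP[delta0 delta1] poor T10 a01 /andP[m0 m1] u0 uv v1 a_le.
have h0 : 0 < v - u by rewrite subr_gt0.
apply: mean_sub_le_deviation => //.
  by rewrite invf_ge1 ?mulr_gt0// mulr_ile1 ?(ltW h0) ?(ltW delta0)//; lra.
(* Here [L = 1 / ((v - u) delta)]: a product of at least [2 L / b] throughout [[u, v]] makes the
   average at least [(v - u) 2 L / b = 2 / (delta b)], the threshold of [wealthy_at]. *)
move=> k /=; set b := (2 ^ k.+1)%:R^-1; rewrite ltNge; apply/negP => H; apply: poor.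
have b0 : 0 < b := dyadic_rate_gt0 k.
have /andP[_ b1] : 0 <= b <= 1 := dyadic_rate_le1 k.
have factor0 t : 0 <= 1 + b * (a t - m).
  have /andP[a0 a1] := a01 t.
  have : 0 <= b * (a t - m + 1) by rewrite mulr_ge0 ?(ltW b0)//; lra.
  lra.
exists k => //; exists T => //=.
apply: (@le_trans _ _ ((\prod_(t < T) (1 + b * (a t - m))) * (v - u))%:E).
  rewrite lee_fin -ler_pdivrMr//; apply: le_trans H.
  rewrite [leLHS](_ : _ = 2 / ((v - u) * delta) / b)// -[dyadic_rate k]/b.
  by field; rewrite !lt0r_neq0.
apply: uniform_wealth_ge => //; first by rewrite prodr_ge0.
move=> y uyv; apply: ler_prod => t _; rewrite factor0 /wager /=.
by rewrite lerD2l ler_wpM2l ?(ltW b0)// a_le.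
Qed.
End UniformMixture.

(** * Values of the deviation in the extended reals *)

Section ExtendedBound.
Context {R : realType} {S : Type}.
Implicit Types (f : S -> R -> R) (x : nat -> S).

(** The first summand is [+oo] and the square root is never [-oo], even when the variance is 0. This
    makes the choice [z = y] in the supremum and the infimum trivial. *)
Lemma deviation_log_level0 f x T y delta : (0 < T)%N ->
  deviation f x T y (log_level T 0 delta) = +oo%E.
Proof.
move=> T0; have TR0 : 0 < T%:R :> R by rewrite ltr0n.
rewrite /deviation /log_level mul0r.
have -> : ((2 * Num.sqrt T%:R)%:E / 0%:E)%E = +oo%E :> \bar R.
  by rewrite inve0 gt0_muley// lte_fin mulr_gt0// sqrtr_gt0.
rewrite /= [(8%:E * +oo)%E]gt0_muley ?lte_fin//.
rewrite inver gt_eqF ?mulr_gt0// gt0_mulye ?lte_fin ?invr_gt0 ?mulr_gt0//.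
by rewrite addye// gt_eqF// (lt_le_trans _ (sqrte_ge0 _)).
Qed.

Lemma deviation_log_level f x T y h delta : (0 < T)%N -> 0 < h -> 0 < delta ->
  deviation f x T y (log_level T h delta) =
  (8 * ln (2 * Num.sqrt T%:R / (h * delta)) / (3 * T%:R) +
   Num.sqrt (4 * ln (2 * Num.sqrt T%:R / (h * delta)) *
     empirical_variance f x T y / T%:R))%:E.
Proof.
move=> T0 h0 delta0; have TR0 : 0 < T%:R :> R by rewrite ltr0n.
have hd0 : 0 < h * delta by rewrite mulr_gt0.
rewrite /deviation /log_level inver gt_eqF// -EFinM lne_EFin; last first.
  by rewrite !divr_gt0// mulr_gt0// sqrtr_gt0.
by rewrite !inver !gt_eqF ?mulr_gt0// -!EFinM /= -EFinD.
Qed.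

End ExtendedBound.

(** * Sample mean and variance under the reflection [1 - f] *)

Section Reflection.
Context {R : realType} {S : Type}.
Implicit Types (f : S -> R -> R) (x : nat -> S).

Lemma mean_onem f x T y : (0 < T)%N ->
  T%:R^-1 * \sum_(t < T) (1 - f (x t) y) = 1 - sample_mean f x T y.
Proof.
move=> T0; rewrite sumrB sumr_const card_ord mulrBr mulVf// pnatr_eq0.
by rewrite -lt0n.
Qed.

Lemma variance_onem f x T y : (0 < T)%N ->
  T%:R^-1 * \sum_(t < T) (1 - f (x t) y - (1 - sample_mean f x T y)) ^+ 2 =
  empirical_variance f x T y.
Proof.
move=> T0; congr (_ * _); apply: eq_bigr => t _.
by rewrite -sqrrN; congr (_ ^+ 2); ring.
Qed.

End Reflection.

(** * The simultaneous confidence band *)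

Theorem mainTheorem3 (R : realType) (d : nat)
    (calX : set 'rV[R]_d) (x0 : calX)
    (P : probability (borel_subset x0) R)
    (dO : measure_display) (Omega : measurableType dO)
    (Pr : probability Omega R)
    (X : nat -> {RV Pr >-> borel_subset x0})
    (f : borel_subset x0 -> R -> R) (delta : R) :
  iid_with_law P X ->
  measurable_fun ([set: borel_subset x0] `*` `[0 : R, 1]) (fun p : borel_subset x0 * R => f p.1 p.2) ->
  (forall x y, y \in `[0, 1] -> f x y \in `[0, 1]) ->
  (forall x, {in `[0, 1] &, {homo f x : y1 y2 / y1 <= y2}}) ->
  0 < delta <= 1 ->
  with_probability_at_least Pr (1 - delta)
    [set w | forall (T : nat) (y : R), (10 <= T)%N -> y \in `[0, 1] ->
       let x := fun t => X t w in
       (lower_bound f x T delta y <= 'E_P[fun x => f x y]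
          <= upper_bound f x T delta y)%E].
Proof.
move=> iid mf f01 f_mono delta01.
have delta0 : 0 < delta by case/andP: delta01.
(* The assumptions on [f] concern levels in [0, 1] only; extending by 0 gives a measurable function
   with values in [0, 1] for all real levels. *)
pose phi (x : borel_subset x0) (y : R) : R :=
  ((fun p : borel_subset x0 * R => f p.1 p.2) \_ (setT `*` `[0 : R, 1])) (x, y).
have phiE x y : y \in `[0, 1] -> phi x y = f x y.
  move=> y01; rewrite /phi patchE ifT// inE; split => //.
have mphi : measurable_fun setT (fun p : borel_subset x0 * R => phi p.1 p.2).
  have /(measurable_restrictT _ (measurableX measurableT (measurable_itv _))) := mf.
  by apply: eq_measurable_fun => -[].
have phi01 x y : 0 <= phi x y <= 1.
  rewrite /phi patchE; case: ifPn => [|_]; last by rewrite lexx ler01.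
  by rewrite inE => -[_ /= /(f01 x)]; rewrite in_itv.
pose psi x y := 1 - phi x y.
have mpsi : measurable_fun setT (fun p : borel_subset x0 * R => psi p.1 p.2).
  by apply: measurable_funB.
have psi01 x y : 0 <= psi x y <= 1 by have /andP[] := phi01 x y; rewrite /psi; lra.
pose F := mean_value P phi.
have mphi_x y : measurable_fun setT (phi^~ y).
  exact: (measurableT_comp mphi (pair2_measurable y)).
have mpsi_x y : measurable_fun setT (psi^~ y).
  exact: (measurableT_comp mpsi (pair2_measurable y)).
have F01 y : 0 <= F y <= 1 by exact: mean_value_itv01.
have FE y : y \in `[0, 1] -> ('E_P[fun x => f x y] = (F y)%:E)%E.
  move=> y01; rewrite unlock mean_valueE//.
  by apply: eq_integral => x _; rewrite phiE.
have F_mono y z : y \in `[0, 1] -> z \in `[0, 1] -> y <= z -> F y <= F z.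
  move=> y01 z01 yz; rewrite -lee_fin !mean_valueE//; apply: ge0_le_integral => //.
  - by move=> x _; rewrite lee_fin; case/andP: (phi01 x y).
  - exact/measurable_EFinP.
  - exact/measurable_EFinP.
  - by move=> x _; rewrite lee_fin !phiE// f_mono.
(* Proved in additive form, where only nonnegative integrals are summed. *)
have psiF y : mean_value P psi y = 1 - F y.
  have : (mean_value P psi y + F y)%:E = 1%E.
    rewrite EFinD !mean_valueE// -ge0_integralD//.
    - under eq_integral do rewrite -EFinD subrK.
      by rewrite integral_cst//= probability_setT mul1e.
    - by move=> x _; rewrite lee_fin; case/andP: (psi01 x y).
    - exact/measurable_EFinP.
    - by move=> x _; rewrite lee_fin; case/andP: (phi01 x y).
    - exact/measurable_EFinP.
  by move=> -[]; lra.
pose bad := wealthy P X phi delta `|` wealthy P X psi delta.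
have mbad1 : measurable (wealthy P X phi delta) by exact: measurable_wealthy.
have mbad2 : measurable (wealthy P X psi delta) by exact: measurable_wealthy.
have mbad : measurable bad := measurableU _ _ mbad1 mbad2.
(* The band event contains this measurable set, and each half of [bad] has probability at most
   [delta / 2]. *)
exists (~` bad).
  split; first exact: measurableC.
  move=> w nbad T y T10 y01.
  have T0 : (0 < T)%N by rewrite (leq_trans _ T10).
  set x := fun t => X t w => /=.
  have [poor1 poor2] : ~ wealthy P X phi delta w /\ ~ wealthy P X psi delta w.
    by split=> ?; apply: nbad; [left|right].
  rewrite FE//; move: (y01); rewrite in_itv/= => /andP[y0 y1].
  apply/andP; split.
    apply: ge_ereal_sup => _ [z] /= + <-; rewrite in_itv/= => /andP[z0].
    have z01 : z <= y -> z \in `[0, 1] by move=> zy; rewrite in_itv/= z0 (le_trans zy).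
    rewrite le_eqVlt => /predU1P[->|zy].
      by rewrite subrr deviation_log_level0// addeNy leNye.
    rewrite deviation_log_level// ?subr_gt0//.
    (* For a level [u] in [[z, y]], [f (x t) z <= f (x t) u] and [F u <= F y] give the required
       domination. *)
    have := @uniform_deviation _ _ _ _ _ _ P X phi mphi phi01 delta w T
      (fun t => f (x t) z) (F y) z y delta01 poor1 T10 _ (F01 y) z0 zy y1 _.
    rewrite -EFinB lee_fin lerBlDr -lerBlDl; apply.
    - by move=> t; have := f01 (x t) z (z01 (ltW zy)); rewrite in_itv.
    - move=> u t /andP[zu uy].
      have u01 : u \in `[0, 1] by rewrite in_itv/= (le_trans z0)// (le_trans uy).
      rewrite lerB//; last exact: F_mono.
      by rewrite phiE// f_mono// z01// ltW.
  apply: le_ereal_inf_tmp => _ [z] /= + <-; rewrite in_itv/= => /andP[yz z1].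
  have z01 : z \in `[0, 1] by rewrite in_itv/= z1 (le_trans y0).
  move: yz; rewrite le_eqVlt => /predU1P[<-|yz].
    by rewrite subrr deviation_log_level0// leey.
  rewrite deviation_log_level// ?subr_gt0//.
  have m01 : 0 <= 1 - F y <= 1 by have /andP[] := F01 y; lra.
  (* For [u] in [[y, z]] the reflected domination reads [F y - f (x t) z <= F u - f (x t) u]. *)
  have := @uniform_deviation _ _ _ _ _ _ P X psi mpsi psi01 delta w T
    (fun t => 1 - f (x t) z) (1 - F y) y z delta01 poor2 T10 _ m01 y0 yz z1 _.
  rewrite /= mean_onem// variance_onem//.
  rewrite -EFinD lee_fin => H.
  suff : 1 - sample_mean f x T z - (1 - F y) <=
      8 * ln (2 * Num.sqrt T%:R / ((z - y) * delta)) / (3 * T%:R) +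
   Num.sqrt (4 * ln (2 * Num.sqrt T%:R / ((z - y) * delta)) *
     empirical_variance f x T z / T%:R) by lra.
  apply: H.
  - by move=> t; have := f01 (x t) z z01; rewrite in_itv/= => /andP[]; lra.
  - move=> u t /andP[yu uz].
    have u01 : u \in `[0, 1] by rewrite in_itv/= (le_trans y0)// (le_trans uz).
    have := F_mono _ _ y01 u01 yu.
    have := f_mono (x t) _ _ u01 z01 uz.
    by rewrite psiF /psi phiE//; lra.
rewrite probability_setC// EFinB leeB//.
apply: (@le_trans _ _ (Pr (wealthy P X phi delta) + Pr (wealthy P X psi delta))%E).
  exact: (measureU2 _ mbad1 mbad2).
rewrite (_ : delta%:E = (delta / 2)%:E + (delta / 2)%:E)%E; last first.
  by rewrite -EFinD; congr EFin; lra.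
by apply: leeD; exact: wealthy_probability.
Qed.
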